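(* Let $k,n_1,n_2\ge 1$ be integers, let $A_1\in\mathbb{R}^{n_1\times k}$ and $A_2\in\mathbb{R}^{n_2\times k}$ be (deterministic) matrices with $A_1^{\intercal}A_1+A_2^{\intercal}A_2=I_k$, and let $X_{n_1,k}$ (an $n_1\times k$ matrix) and $X_{n_2,k}$ (an $n_2\times k$ matrix) be random real matrices all of whose entries (across both matrices) are independent, identically distributed symmetric random variables with variance $1$ and all moments finite. For $\theta\ge 0$ let $$g_\theta(u)=\mathbb{E}\left\{\det\left[(u-1)(A_1+\sqrt{\theta}X_{n_1,k})^{\intercal}(A_1+\sqrt{\theta}X_{n_1,k})+u\,(A_2+\sqrt{\theta}X_{n_2,k})^{\intercal}(A_2+\sqrt{\theta}X_{n_2,k})\right]\right\}.$$ Suppose that the roots $\lambda_1,\dots,\lambda_k$ of $g_0$ are distinct, and let $\lambda_1(\theta),\dots,\lambda_k(\theta)$ be differentiable functions on $[0,\varepsilon)$, for some $\varepsilon>0$, with $\lambda_i(0)=\lambda_i$ and $g_\theta(\lambda_i(\theta))=0$ for all $\theta\in[0,\varepsilon)$ and all $i$. Then for every $i$ the (one-sided) derivative at $\theta=0$ satisfies $$\frac{\partial\lambda_i}{\partial\theta}\bigg|_{\theta=0}=-n_1(\lambda_i-1)-n_2\lambda_i+\sum_{j\neq i}\frac{\lambda_i(1-\lambda_j)+\lambda_j(1-\lambda_i)}{\lambda_i-\lambda_j}.$$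
   Context: A random variable $Y$ is symmetric if $Y$ and $-Y$ have the same distribution. $M^{\intercal}$ denotes the transpose of $M$. Note that $g_0(u)=\det[uI_k-A_1^{\intercal}A_1]$ is monic of degree $k$. *)

(* Defs.v *)
From HB Require Import structures.
From mathcomp Require Import all_boot all_order all_algebra.
From mathcomp Require Import all_classical all_reals all_analysis.

Set Implicit Arguments.
Unset Strict Implicit.
Unset Printing Implicit Defensive.

Import Order.TTheory GRing.Theory Num.Theory.
Import numFieldNormedType.Exports.

Local Open Scope classical_set_scope.
Local Open Scope ring_scope.

Section RandomVariables.
Context (d : measure_display) (T : measurableType d) (R : realType).
Variable P : probability T R.

(* The law of [X], i.e. [distribution P X], is by definition [pushforward P X];
   the latter also applies to [\- X] without packaging it as a random variable.
   Laws are compared on measurable sets only: their values elsewhere carry no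
   meaning. *)
Definition same_distribution (X Y : T -> R) : Prop :=
  forall B : set R, measurable B -> pushforward P X B = pushforward P Y B.

Definition symmetric_RV (X : {RV P >-> R}) : Prop :=
  same_distribution X (\- X).

Definition finite_moments (X : {RV P >-> R}) : Prop :=
  forall m : nat, P.-integrable setT (EFin \o (fun w => X w ^+ m)).

Definition mutually_independent (I : finType) (X : I -> {RV P >-> R}) : Prop :=
  forall (J : {set I}) (B : I -> set R), (forall i, measurable (B i)) ->
    P (\bigcap_(i in [set i | i \in J]) (X i @^-1` B i)) =
    (\prod_(i in J) P (X i @^-1` B i))%E.

Definition entries (n1 n2 k : nat) (X1 : 'I_n1 -> 'I_k -> {RV P >-> R})
    (X2 : 'I_n2 -> 'I_k -> {RV P >-> R})
    (s : ('I_n1 * 'I_k) + ('I_n2 * 'I_k)) : {RV P >-> R} :=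
  match s with inl p => X1 p.1 p.2 | inr p => X2 p.1 p.2 end.

Definition perturbed (n k : nat) (A : 'M[R]_(n, k))
    (X : 'I_n -> 'I_k -> {RV P >-> R}) (theta : R) (w : T) : 'M[R]_(n, k) :=
  A + Num.sqrt theta *: \matrix_(i, j) X i j w.

(* [fine] loses nothing when the entries have all moments and are independent:
   the determinant is a polynomial in them, hence integrable. *)
Definition g (n1 n2 k : nat) (A1 : 'M[R]_(n1, k)) (A2 : 'M[R]_(n2, k))
    (X1 : 'I_n1 -> 'I_k -> {RV P >-> R}) (X2 : 'I_n2 -> 'I_k -> {RV P >-> R})
    (theta u : R) : R :=
  fine ('E_P[fun w =>
    let Y1 := perturbed A1 X1 theta w in
    let Y2 := perturbed A2 X2 theta w in
    \det ((u - 1) *: (Y1^T *m Y1) + u *: (Y2^T *m Y2))])%E.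

End RandomVariables.

Section OneSidedDerivative.
Context (R : realType).

Definition is_right_derivative (f : R -> R) (x l : R) : Prop :=
  (f (x + h) - f x) / h @[h --> 0^'+] --> l.

(* Differentiability of [f] restricted to [a, b): the values of [f] outside
   [a, b) play no role. *)
Definition differentiable_co (f : R -> R) (a b : R) : Prop :=
  (exists l, is_right_derivative f a l) /\
  (forall x, a < x < b -> derivable f x 1).

End OneSidedDerivative.

(* Main.v *)
(* Write s = sqrt theta.  The determinant is a polynomial in s whose coefficient
   of s^m is homogeneous of degree m in the entries of X, so taking expectations
   gives g_theta(u) = g_0(u) + theta h(u) + O(theta^(3/2)), where h is the trace
   of the quadratic form in degree 2.  For M = uI - A1^T A1 invertible, perturbing
   a single entry is a rank 2 perturbation of M, and summing over all entries gives
     h = g_0 [(n1 (u-1) + n2 u) tr M^-1 + u (1-u) (tr M^-2 - (tr M^-1)^2)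
              + (2u-1) (1-k) tr M^-1].
   With tr M^-1 = sum_j 1/(u - l_j), the limit u -> l_i gives h(l_i)/g_0'(l_i), and
   the derivative of the i-th root is -h(l_i)/g_0'(l_i). *)
Require Import Defs.
From HB Require Import structures.
From mathcomp Require Import all_boot all_order all_algebra.
From mathcomp Require Import all_classical all_reals all_analysis.
From mathcomp Require Import perm measurable_realfun ring lra.

Import Order.TTheory GRing.Theory Num.Theory.
Import numFieldNormedType.Exports.

Local Open Scope classical_set_scope.
Local Open Scope ring_scope.

(** * Determinants of rank 2 perturbations *)

(** Sylvester's identity: multiplying the block matrix with rows [1, - A] and [B, 1] by a unipotent
    block matrix on its right or on its left clears the corner [- A] and leaves [1 + B *m A] or
    [1 + A *m B] on the diagonal. *)
Lemma det_1_add_mulmxC {R : comNzRingType} {m n : nat} (A : 'M[R]_(m, n)) (B : 'M[R]_(n, m)) :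
  \det (1%:M + A *m B) = \det (1%:M + B *m A).
Proof.
have e1 : block_mx (1%:M : 'M[R]_m) (- A) B (1%:M : 'M[R]_n) *m block_mx 1%:M A 0 1%:M
  = block_mx 1%:M 0 B (1%:M + B *m A).
  by rewrite mulmx_block !(mul1mx, mulmx1, mulmx0, addr0, mulNmx) addrN addrC.
have e2 : block_mx (1%:M : 'M[R]_m) A 0 (1%:M : 'M[R]_n) *m block_mx 1%:M (- A) B 1%:M
  = block_mx (1%:M + A *m B) 0 B 1%:M.
  by rewrite mulmx_block !(mul1mx, mulmx1, mul0mx, add0r, mulNmx) addNr.
have := congr1 determinant e1; have := congr1 determinant e2.
by rewrite !det_mulmx !det_ublock !det_lblock !det1 !mul1r !mulr1 => -> ->.
Qed.

Lemma det_mx2 {R : comNzRingType} (M : 'M[R]_(1 + 1)) :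
  \det M = M 0 0 * M (rshift 1 0) (rshift 1 0) - M 0 (rshift 1 0) * M (rshift 1 0) 0.
Proof.
rewrite (expand_det_row _ 0) !big_ord_recl big_ord0 addr0 /cofactor !det_mx11 !mxE.
rewrite /= expr0 expr1 mul1r mulN1r mulrN.
by congr (_ * M _ _ - M _ _ * M _ _); apply: val_inj.
Qed.

(* With [v = b^T] and [e] the [j]-th basis vector, the perturbation
   [c x (e v^T + v e^T) + c x^2 e e^T] has rank 2. *)
Lemma det_rank_two_perturbation {F : fieldType} {k : nat} (M : 'M[F]_k)
    (b : 'rV[F]_k) (j : 'I_k) (c x : F) :
  M \in unitmx ->
  let e := delta_mx j 0 : 'cV[F]_k in
  let N := invmx M in
  let beta := (b *m N *m e) 0 0 in
  M^T = M ->
  \det (M + c *: ((b + x *: e^T)^T *m (b + x *: e^T) - b^T *m b)) =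
  \det M * (1 + x * (2 * c * beta) +
    x ^+ 2 * (c ^+ 2 * beta ^+ 2 + c * N j j - c ^+ 2 * N j j * (b *m N *m b^T) 0 0)).
Proof.
move=> uM e N beta symM.
have NT : N^T = N by rewrite trmx_inv symM.
(* The perturbation equals [U *m W] with inner dimension 2, so Sylvester's identity leaves a
   determinant of size 2. *)
pose U : 'M[F]_(k, 1 + 1) := row_mx ((c * x) *: e) ((c * x) *: b^T + (c * x ^+ 2) *: e).
pose W : 'M[F]_(1 + 1, k) := col_mx b e^T.
have -> : M + c *: ((b + x *: e^T)^T *m (b + x *: e^T) - b^T *m b) = M *m (1%:M + (N *m U) *m W).
  rewrite [M *m (1%:M + _)]mulmxDr mulmx1 !mulmxA mulmxV // mul1mx /U /W mul_row_col; congr (_ + _).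
  have -> : (b + x *: e^T)^T = b^T + x *: e by apply/matrixP => i0 l0; rewrite !mxE.
  rewrite mulmxDl !mulmxDr mulmxDl.
  rewrite !(=^~ scalemxAl, =^~ scalemxAr) scalerA.
  set p := b^T *m b; set q := e *m b; set r := b^T *m e^T; set s := e *m e^T.
  rewrite -[p + _ + _]addrA [p + _]addrC addrK !scalerDr !scalerA.
  by rewrite addrCA -expr2.
rewrite det_mulmx det_1_add_mulmxC; congr (_ * _).
rewrite det_mx2 /U /W mul_mx_row mul_col_row.
set al := (b *m N *m b^T) 0 0.
have zl : (0 : 'I_(1 + 1)) = lshift 1 (0 : 'I_1) by apply: val_inj.
have h1 : (b *m N *m e) 0 0 = beta by [].
have h2 : (e^T *m N *m b^T) 0 0 = beta.
  have -> : e^T *m N *m b^T = (b *m N *m e)^T by rewrite !trmx_mul NT mulmxA.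
  by rewrite mxE.
have h3 : (e^T *m N *m e) 0 0 = N j j.
  by rewrite /e trmx_delta -rowE -colE !mxE.
have zE (A : 'M[F]_1) (a : F) : (a *: A) 0 0 = a * A 0 0 by rewrite mxE.
have dE (A B : 'M[F]_1) : (A + B) 0 0 = A 0 0 + B 0 0 by rewrite mxE.
have idE (i l : 'I_(1 + 1)) (A : 'M[F]_(1 + 1)) : (1%:M + A) i l = (i == l)%:R + A i l.
  by rewrite !mxE.
rewrite !idE zl block_mxEul block_mxEur block_mxEdl block_mxEdr.
rewrite !(mulmxDr, =^~ scalemxAr) !mulmxA !dE !zE h1 h2 h3 -/al.
rewrite !eqxx eq_lrshift eq_rlshift /=; set nu := N j j.
ring.
Qed.

(** A Gram matrix is the sum of the outer squares of the rows, and only row [a] changes. *)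
Lemma gram_delta_mx {F : comNzRingType} {n k : nat} (B : 'M[F]_(n, k)) (a : 'I_n) (j : 'I_k) (x : F) :
  let e := delta_mx j 0 : 'cV[F]_k in let b := row a B in
  (B + x *: delta_mx a j)^T *m (B + x *: delta_mx a j) =
  B^T *m B + ((b + x *: e^T)^T *m (b + x *: e^T) - b^T *m b).
Proof.
move=> e b; apply/matrixP => p q; rewrite !mxE !big_ord1 !mxE.
rewrite [LHS](bigD1 a) //= [in RHS](bigD1 a) //= !mxE !eqxx !andbT /=.
rewrite (eq_bigr (fun i => B^T p i * B i q)); last first.
  by move=> i /negPf ia; rewrite !mxE ia /= mulr0 !addr0.
ring.
Qed.

(** The summand is, up to the factor [\det M], the coefficient of [x ^+ 2] in the rank 2 formula.
    Each sum over entries is a trace; symmetry of [N] turns the squared entries of [B *m N] into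
    [\tr (N *m N *m (B^T *m B))]. *)
Lemma sum_rank_two_coef {F : comNzRingType} {n k : nat} (B : 'M[F]_(n, k)) (N : 'M[F]_k) (c : F) :
  N^T = N ->
  \sum_a \sum_j (c ^+ 2 * ((row a B *m N *m (delta_mx j 0 : 'cV[F]_k)) 0 0) ^+ 2 + c * N j j
     - c ^+ 2 * N j j * (row a B *m N *m (row a B)^T) 0 0) =
  c ^+ 2 * \tr (N *m N *m (B^T *m B)) + c * n%:R * \tr N
    - c ^+ 2 * \tr N * \tr (N *m (B^T *m B)).
Proof.
move=> NT.
have eb a j : (row a B *m N *m (delta_mx j 0 : 'cV[F]_k)) 0 0 = (B *m N) a j.
  by rewrite -colE -row_mul !mxE.
have ea a : (row a B *m N *m (row a B)^T) 0 0 = (B *m N *m B^T) a a.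
  by rewrite -!row_mul !mxE; apply: eq_bigr => i _; rewrite !mxE.
under eq_bigr do under eq_bigr do rewrite eb ea.
transitivity (\sum_a (c ^+ 2 * \sum_j (B *m N) a j ^+ 2 + c * \tr N
   - c ^+ 2 * \tr N * (B *m N *m B^T) a a)).
  apply: eq_bigr => a _; rewrite sumrB big_split /= !mulr_sumr; congr (_ + _ - _).
  by rewrite mulr_suml.
rewrite sumrB big_split /= -!mulr_sumr sumr_const card_ord.
have -> : \sum_a (B *m N *m B^T) a a = \tr (N *m (B^T *m B)).
  by rewrite -[LHS]/(\tr _) -mulmxA mxtrace_mulC mulmxA.
have -> : \sum_a \sum_j (B *m N) a j ^+ 2 = \tr (N *m N *m (B^T *m B)).
  transitivity (\tr (B *m N *m (B *m N)^T)).
    by apply: eq_bigr => a _; rewrite mxE; apply: eq_bigr => j _; rewrite [X in _ * X]mxE expr2.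
  by rewrite trmx_mul NT mulmxA -!mulmxA mxtrace_mulC !mulmxA.
by rewrite -mulr_natr; ring.
Qed.

(** * Diagonalisation and traces of the resolvent *)

(* A symmetric matrix whose characteristic polynomial has [k] distinct roots is
   diagonalisable because eigenvectors for distinct eigenvalues are orthogonal. *)
Lemma symmetric_distinct_roots_diag {F : realFieldType} {k : nat} (G : 'M[F]_k) (l : 'I_k -> F) :
  G^T = G -> injective l -> (forall j, \det ((l j)%:M - G) = 0) ->
  exists2 Q : 'M[F]_k, Q \in unitmx & Q *m G = diag_mx (\row_j l j) *m Q.
Proof.
move=> GT linj hl.
have /fin_all_exists2[v v0 vG] j : exists2 v : 'rV[F]_k, v != 0 & v *m G = l j *: v.
  have /eqP/det0P[v v0 /eqP] := hl j.
  rewrite mulmxBr mul_mx_scalar subr_eq0 => /eqP vE.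
  by exists v.
have orth i j : i != j -> v i *m (v j)^T = 0.
  move=> ij; have : (l i - l j) *: (v i *m (v j)^T) = 0.
    rewrite scalerBl scalemxAl -vG [l j *: _]scalemxAr.
    have -> : l j *: (v j)^T = (v j *m G)^T by rewrite vG; apply/matrixP => p q; rewrite !mxE.
    by rewrite trmx_mul GT mulmxA subrr.
  move/eqP; rewrite scaler_eq0 subr_eq0 => /orP[/eqP/linj eij|/eqP//].
  by rewrite eij eqxx in ij.
pose Q : 'M[F]_k := \matrix_(i, j) v i 0 j.
have rQ i : row i Q = v i by apply/rowP => j; rewrite !mxE.
exists Q.
  (* Orthogonality of the rows makes [Q *m Q^T] diagonal, and its diagonal entries are squared norms
     of nonzero vectors, so [Q] is invertible. *)
  have QQ : Q *m Q^T = diag_mx (\row_j (v j *m (v j)^T) 0 0).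
    apply/matrixP => i j; rewrite !mxE.
    have -> : \sum_p Q i p * Q^T p j = (v i *m (v j)^T) 0 0.
      by rewrite mxE; apply: eq_bigr => p _; rewrite !mxE.
    by case: eqVneq => [->|/orth ->]; rewrite ?mulr1n // mxE.
  have : \det (Q *m Q^T) != 0.
    rewrite QQ det_diag; apply/prodf_neq0 => j _; rewrite mxE.
    apply: contra (v0 j); rewrite mxE => /eqP h; apply/eqP/rowP => p; rewrite mxE.
    have /psumr_eq0P : \sum_p v j 0 p ^+ 2 = 0.
      by rewrite -[RHS]h; apply: eq_bigr => i _; rewrite !mxE.
    move=> /(_ (fun i _ => sqr_ge0 _)) /(_ p isT) /eqP.
    by rewrite sqrf_eq0 => /eqP.
  by rewrite det_mulmx mulf_eq0 negb_or unitmxE unitfE => /andP[].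
apply/row_matrixP => i; rewrite !row_mul rQ vG.
by rewrite row_diag_mx mxE -scalemxAl -rowE rQ.
Qed.

(** [M] is conjugate by [Q] to the diagonal matrix of the [u - l j], and determinants and traces are
    invariant under conjugation. *)
Lemma resolvent_diag {F : fieldType} {k : nat} (G Q : 'M[F]_k) (l : 'I_k -> F) (u : F) :
  Q \in unitmx -> Q *m G = diag_mx (\row_j l j) *m Q ->
  let M := u%:M - G in
  \det M = \prod_j (u - l j) /\
  ((forall j, u != l j) ->
   \tr (invmx M) = \sum_j (u - l j)^-1 /\
   \tr (invmx M *m invmx M) = \sum_j (u - l j)^-1 ^+ 2).
Proof.
move=> uQ QG M.
pose D : 'M[F]_k := diag_mx (\row_j (u - l j)).
have QM : Q *m M = D *m Q.
  rewrite mulmxBr QG mul_mx_scalar -mul_scalar_mx -mulmxBl; congr (_ *m _).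
  by apply/matrixP => i j; rewrite !mxE -mulrnBl.
have ME : M = invmx Q *m D *m Q by rewrite -mulmxA -QM mulKmx.
have detM : \det M = \prod_j (u - l j).
  rewrite ME !det_mulmx mulrAC -det_mulmx mulVmx // det1 mul1r det_diag.
  by apply: eq_bigr => j _; rewrite mxE.
split=> // ul.
pose D' : 'M[F]_k := diag_mx (\row_j (u - l j)^-1).
have DD' : D *m D' = 1%:M.
  rewrite mulmx_diag; apply/matrixP => i j; rewrite !mxE mulfV ?subr_eq0 //.
pose N := invmx Q *m D' *m Q.
have MN : M *m N = 1%:M.
  by rewrite ME /N !mulmxA mulmxK // -[_ *m D *m D']mulmxA DD' mulmx1 mulVmx.
have uM : M \in unitmx by case: (mulmx1_unit MN).
have -> : invmx M = N by rewrite -[RHS](mulKmx uM) MN mulmx1.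
have trQ (A : 'M[F]_k) : \tr (invmx Q *m A *m Q) = \tr A.
  by rewrite mxtrace_mulC mulmxA mulmxV // mul1mx.
split.
  by rewrite trQ mxtrace_diag; apply: eq_bigr => j _; rewrite mxE.
have -> : N *m N = invmx Q *m (D' *m D') *m Q by rewrite /N !mulmxA mulmxK.
by rewrite trQ mulmx_diag mxtrace_diag; apply: eq_bigr => j _; rewrite !mxE expr2.
Qed.

(** * Integrability, symmetry and independence *)

(** The induction on [t] carries all powers of the monomial at once: [|x * y| <= x ^+ 2 + y ^+ 2]
    bounds a power of a product by higher powers of its factors. *)
Lemma integrable_monomial {d} {T : measurableType d} {R : realType}
    (P : probability T R) {I : Type} (X : I -> {RV P >-> R}) :
  (forall p, finite_moments (X p)) ->
  forall t : seq I, P.-integrable setT (EFin \o (fun w => \prod_(p <- t) X p w)).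
Proof.
move=> hX t.
suff: measurable_fun setT (fun w => \prod_(p <- t) X p w) /\
  forall m : nat, P.-integrable setT (EFin \o (fun w => (\prod_(p <- t) X p w) ^+ m)).
  by move=> [_ /(_ 1%N)].
elim: t => [|p t [mt It]].
  split; first by under eq_fun do rewrite big_nil; exact: measurable_cst.
  move=> m; under eq_fun do rewrite big_nil expr1n.
  exact: finite_measure_integrable_cst.
have mpt : measurable_fun setT (fun w => \prod_(q <- p :: t) X q w).
  under eq_fun do rewrite big_cons.
  by apply: measurable_funM.
split=> // m.
have I2 : P.-integrable setT (EFin \o (fun w => X p w ^+ (m * 2)))
  by exact: hX.
have := integrableD measurableT I2 (It (m * 2)%N).
apply: le_integrable => //.
  apply/measurable_EFinP; exact: measurable_funX.
move=> w _ /=; rewrite lee_fin big_cons exprMn.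
set a := X p w; set b := \prod_(_ <- _) _.
rewrite !exprM -/a; set x := a ^+ m; set y := b ^+ m.
have xy0 : 0 <= x ^+ 2 + y ^+ 2 by rewrite addr_ge0 ?sqr_ge0.
rewrite (ger0_norm xy0) ler_norml; apply/andP; split; nra.
Qed.

(** An expectation depends only on the law, so the mean equals its own opposite. *)
Lemma expectation_symmetric {d} {T : measurableType d} {R : realType}
    (P : probability T R) (X : {RV P >-> R}) :
  symmetric_RV X -> P.-integrable setT (EFin \o X) ->
  (\int[P]_w (X w)%:E = 0)%E.
Proof.
move=> sX iX.
have mN : measurable_fun setT (\- X : T -> R) by exact: measurableT_comp.
pose NX : {mfun T >-> R} := HB.pack (\- X : T -> R) (isMeasurableFun.Build _ _ _ _ _ mN).
have e1 := integral_distribution (P := P) (X := X) (f := EFin) (@EFin_measurable R setT) iX.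
have e2 := integral_distribution (P := P) (X := NX) (f := EFin) (@EFin_measurable R setT)
  (integrableN iX).
have e3 : (\int[distribution P X]_y (y%:E) = \int[distribution P NX]_y (y%:E))%E.
  apply: (eq_measure_integral (distribution P NX)) => A mA _.
  exact: sX.
have e4 : (\int[P]_w (X w)%:E = - \int[P]_w (X w)%:E)%E.
  rewrite -[RHS]mulN1e -(integralZl measurableT iX (-1)) /=.
  rewrite -[LHS]e1 e3 [LHS]e2.
  by apply: eq_integral => w _ /=; rewrite -EFinM mulN1r.
have := integrable_fin_num measurableT iX.
move: e4; rewrite /=; case: (\int[P]_w _)%E => // r [] rr _.
by congr EFin; lra.
Qed.

(** The law of the pair agrees with the product of the two laws on rectangles, hence everywhere by
    uniqueness of the product measure; Fubini's theorem then splits the integral. *)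
Lemma expectation_mul_independent {d} {T : measurableType d} {R : realType}
    (P : probability T R) (X Y : {RV P >-> R}) :
  (forall A B, measurable A -> measurable B ->
    P (X @^-1` A `&` Y @^-1` B) = (P (X @^-1` A) * P (Y @^-1` B))%E) ->
  P.-integrable setT (EFin \o X) -> P.-integrable setT (EFin \o Y) ->
  P.-integrable setT (EFin \o (fun w => X w * Y w)) ->
  (\int[P]_w (X w * Y w)%:E = (\int[P]_w (X w)%:E) * \int[P]_w (Y w)%:E)%E.
Proof.
move=> hXY iX iY iXY.
have mZ : measurable_fun setT (fun w => (X w, Y w)) by exact: measurable_fun_pair.
pose Z : {mfun T >-> (R * R)%type} := HB.pack (fun w => (X w, Y w)) (isMeasurableFun.Build _ _ _ _ _ mZ).
pose f (z : R * R) : \bar R := (z.1 * z.2)%:E.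
have mf : measurable_fun setT f.
  by apply/measurable_EFinP; apply: measurable_funM.
have e1 := integral_distribution (P := P) (X := Z) mf iXY.
have if' := integrable_pushforward mZ mf iXY measurableT.
have eqm : forall A, measurable A ->
  (distribution P X \x distribution P Y)%E A = distribution P Z A.
  by apply: product_measure_unique => A B mA mB; exact: hXY.
have ifp : (distribution P X \x distribution P Y)%E.-integrable setT f.
  apply/integrableP; split => //.
  have /integrableP[_] := if'; apply: le_lt_trans.
  rewrite le_eqVlt; apply/orP; left; apply/eqP.
  apply: (eq_measure_integral (distribution P Z)) => A mA _.
  exact: eqm.
transitivity (\int[distribution P X \x distribution P Y]_z f z)%E.
  rewrite -[LHS]e1; apply: (eq_measure_integral (distribution P X \x distribution P Y)%E) => A mA _.
  exact/esym/eqm.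
rewrite -(integral12_prod_meas1 ifp).
have eY := integral_distribution (P := P) (X := Y) (f := EFin) (@EFin_measurable R setT) iY.
have eX := integral_distribution (P := P) (X := X) (f := EFin) (@EFin_measurable R setT) iX.
have iY' := integrable_pushforward (measurable_funP Y) (@EFin_measurable R setT) iY measurableT.
have iX' := integrable_pushforward (measurable_funP X) (@EFin_measurable R setT) iX measurableT.
pose c := fine (\int[distribution P Y]_y y%:E).
have cE : (\int[distribution P Y]_y y%:E = c%:E)%E.
  by rewrite fineK // (integrable_fin_num measurableT iY').
have -> : (\int[P]_w (Y w)%:E = c%:E)%E by rewrite -cE eY.
have -> : (\int[P]_w (X w)%:E = \int[distribution P X]_x x%:E)%E by rewrite eX.
rewrite -(integralZr measurableT iX').
apply: eq_integral => x _; rewrite -cE -(integralZl measurableT iY').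
by apply: eq_integral => y _; rewrite /f EFinM.
Qed.

(** * Polynomial expansions in the entries *)

(** The naturals below [size (p - q)] are distinct in [R], so a nonzero [p - q] would have too many
    roots. This serves to compare coefficients in [s]. *)
Lemma poly_horner_inj {R : numDomainType} (p q : {poly R}) :
  (forall x, p.[x] = q.[x]) -> p = q.
Proof.
move=> pq; apply/eqP; rewrite -subr_eq0; apply/negP => /negP pq0.
pose rs := [seq n%:R : R | n <- iota 0 (size (p - q))].
have := @max_poly_roots _ (p - q) rs pq0.
rewrite size_map size_iota ltnn => /(_ _ _)/notF; apply.
  by apply/allP => x _; rewrite rootE hornerD hornerN pq subrr.
rewrite map_inj_uniq ?iota_uniq // => m n /eqP.
by rewrite eqr_nat => /eqP.
Qed.

(* [F s u x] is a polynomial in which [s] counts the degree in [x]. *)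
Definition has_expansion {R : comNzRingType} {I : Type}
    (F : R -> R -> (I -> R) -> R) (L : seq (seq I * {poly R})) : Prop :=
  forall s u x, F s u x = \sum_(m <- L) m.2.[u] * s ^+ size m.1 * \prod_(p <- m.1) x p.

Lemma expansion_poly {R : comNzRingType} {I : Type} (c : {poly R}) :
  exists L, has_expansion (fun s u (x : I -> R) => c.[u]) L.
Proof.
by exists [:: ([::], c)] => s u x; rewrite big_seq1 big_nil expr0 !mulr1.
Qed.

Lemma expansion_var {R : comNzRingType} {I : Type} (p : I) :
  exists L, has_expansion (fun (s u : R) x => s * x p) L.
Proof.
by exists [:: ([:: p], 1)] => s u x; rewrite big_seq1 big_seq1 hornerC expr1 mul1r.
Qed.

Lemma expansionD {R : comNzRingType} {I : Type} (F G : R -> R -> (I -> R) -> R) :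
  (exists L, has_expansion F L) -> (exists L, has_expansion G L) ->
  exists L, has_expansion (fun s u x => F s u x + G s u x) L.
Proof.
by move=> [L hL] [M hM]; exists (L ++ M) => s u x; rewrite big_cat hL hM.
Qed.

Lemma expansionM {R : comNzRingType} {I : Type} (F G : R -> R -> (I -> R) -> R) :
  (exists L, has_expansion F L) -> (exists L, has_expansion G L) ->
  exists L, has_expansion (fun s u x => F s u x * G s u x) L.
Proof.
move=> [L hL] [M hM].
exists [seq (l.1 ++ m.1, l.2 * m.2) | l <- L, m <- M] => s u x.
rewrite big_allpairs_dep hL hM mulr_suml; apply: eq_bigr => l _.
rewrite mulr_sumr; apply: eq_bigr => m _ /=.
by rewrite big_cat size_cat exprD hornerM /=; ring.
Qed.

Lemma expansion_sum {R : comNzRingType} {I J : Type} (r : seq J) (F : J -> R -> R -> (I -> R) -> R) :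
  (forall j, exists L, has_expansion (F j) L) ->
  exists L, has_expansion (fun s u x => \sum_(j <- r) F j s u x) L.
Proof.
move=> hF; elim: r => [|j r [L hL]].
  by exists [::] => s u x; rewrite !big_nil.
have [M hM] := expansionD _ _ (hF j) (ex_intro _ L hL).
by exists M => s u x; rewrite big_cons -hM.
Qed.

Lemma expansion_prod {R : comNzRingType} {I J : Type} (r : seq J) (F : J -> R -> R -> (I -> R) -> R) :
  (forall j, exists L, has_expansion (F j) L) ->
  exists L, has_expansion (fun s u x => \prod_(j <- r) F j s u x) L.
Proof.
move=> hF; elim: r => [|j r [L hL]].
  have [M hM] := expansion_poly (I := I) (1 : {poly R}).
  by exists M => s u x; rewrite big_nil -hM hornerC.
have [M hM] := expansionM _ _ (hF j) (ex_intro _ L hL).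
by exists M => s u x; rewrite big_cons -hM.
Qed.

(** The Leibniz formula uses only sums and products. *)
Lemma expansion_det {R : comNzRingType} {I : Type} {k : nat} (F : R -> R -> (I -> R) -> 'M[R]_k) :
  (forall i j, exists L, has_expansion (fun s u x => F s u x i j) L) ->
  exists L, has_expansion (fun s u x => \det (F s u x)) L.
Proof.
move=> hF.
have [L hL] := expansion_sum (index_enum {perm 'I_k}) _ (fun sg => expansionM _ _
  (expansion_poly ((-1) ^+ sg)%:P)
  (expansion_prod (index_enum 'I_k) _ (fun i => hF i (sg i)))).
exists L => s u x; rewrite -hL; apply: eq_bigr => sg _.
by rewrite hornerC.
Qed.

(** * Coefficients of degree 0 and 2 of the determinant *)

(** The matrix inside [g], with free variables [x] for the random entries and [s] for the square
    root of [theta]; this separates the algebra from the probability. *)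
Definition pencil {R : comNzRingType} {n1 n2 k : nat} (A1 : 'M[R]_(n1, k)) (A2 : 'M[R]_(n2, k))
    (s u : R) (x : ('I_n1 * 'I_k) + ('I_n2 * 'I_k) -> R) : 'M[R]_k :=
  let Y1 := A1 + s *: \matrix_(i, j) x (inl (i, j)) in
  let Y2 := A2 + s *: \matrix_(i, j) x (inr (i, j)) in
  (u - 1) *: (Y1^T *m Y1) + u *: (Y2^T *m Y2).

Lemma expansion_det_pencil {R : comNzRingType} {n1 n2 k : nat}
    (A1 : 'M[R]_(n1, k)) (A2 : 'M[R]_(n2, k)) :
  exists L, has_expansion (fun s u x => \det (pencil A1 A2 s u x)) L.
Proof.
apply: expansion_det => i j.
have lin (n : nat) (A : 'M[R]_(n, k)) (e : 'I_n * 'I_k -> ('I_n1 * 'I_k) + ('I_n2 * 'I_k)) a b :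
  exists L, has_expansion (fun s (u : R) x => (A + s *: \matrix_(i, j) x (e (i, j))) a b) L.
  have [L hL] := expansionD _ _ (expansion_poly (A a b)%:P) (expansion_var (e (a, b))).
  by exists L => s u x; rewrite -hL !mxE hornerC.
have quad (n : nat) (A : 'M[R]_(n, k)) (e : 'I_n * 'I_k -> ('I_n1 * 'I_k) + ('I_n2 * 'I_k)) :
  exists L, has_expansion (fun s (u : R) x =>
    ((A + s *: \matrix_(i, j) x (e (i, j)))^T *m (A + s *: \matrix_(i, j) x (e (i, j)))) i j) L.
  have [L hL] := expansion_sum (index_enum 'I_n) _
    (fun a => expansionM _ _ (lin n A e a i) (lin n A e a j)).
  exists L => s u x; rewrite -hL mxE; apply: eq_bigr => a _.
  by rewrite [X in X * _ = _]mxE.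
have [L hL] := expansionD _ _
  (expansionM _ _ (expansion_poly ('X - 1)) (quad n1 A1 inl))
  (expansionM _ _ (expansion_poly 'X) (quad n2 A2 inr)).
by exists L => s u x; rewrite -hL !hornerE /pencil mxE [X in X + _ = _]mxE [X in _ + X = _]mxE.
Qed.

Lemma pencil0 {R : comNzRingType} {n1 n2 k : nat} (A1 : 'M[R]_(n1, k)) (A2 : 'M[R]_(n2, k)) u x :
  A1^T *m A1 + A2^T *m A2 = 1%:M -> pencil A1 A2 0 u x = u%:M - A1^T *m A1.
Proof.
move=> hA; rewrite /pencil !scale0r !addr0.
have -> : A2^T *m A2 = 1%:M - A1^T *m A1 by rewrite -hA addrC addKr.
by rewrite scalerBr scalerBl scale1r scalemx1 addrC addrA subrK.
Qed.

(** At [s = 0] only the terms without variables survive. *)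
Lemma expansion_degree0 {R : comNzRingType} {n1 n2 k : nat} (A1 : 'M[R]_(n1, k)) (A2 : 'M[R]_(n2, k)) L u :
  A1^T *m A1 + A2^T *m A2 = 1%:M ->
  has_expansion (fun s u x => \det (pencil A1 A2 s u x)) L ->
  \sum_(m <- L | size m.1 == 0) m.2.[u] = \det (u%:M - A1^T *m A1).
Proof.
move=> hA hL; rewrite -(pencil0 A1 A2 u (fun=> 0) hA) [RHS]hL big_mkcond.
apply: eq_bigr => -[[|p t] c] _ /=; first by rewrite big_nil expr0 !mulr1.
by rewrite expr0n mulr0 mul0r.
Qed.

(* The coefficient of [s^2] is a quadratic form in [x]; its trace is obtained by
   evaluating at the coordinate vectors, which perturb the matrix by rank 2. *)
Lemma expansion_degree2 {R : realFieldType} {n1 n2 k : nat} (A1 : 'M[R]_(n1, k)) (A2 : 'M[R]_(n2, k)) L u :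
  A1^T *m A1 + A2^T *m A2 = 1%:M ->
  has_expansion (fun s u x => \det (pencil A1 A2 s u x)) L ->
  let M := u%:M - A1^T *m A1 in
  let t1 := \tr (invmx M) in let t2 := \tr (invmx M *m invmx M) in
  M \in unitmx ->
  \sum_(m <- L | size m.1 == 2) m.2.[u] * \sum_p \prod_(q <- m.1) (q == p)%:R =
  \det M * ((n1%:R * (u - 1) + n2%:R * u) * t1 + u * (1 - u) * (t2 - t1 ^+ 2)
            + (2 * u - 1) * (1 - k%:R) * t1).
Proof.
move=> hA hL M t1 t2 uM.
set N := invmx M in t1 t2 *.
have G1T : (A1^T *m A1)^T = A1^T *m A1 by rewrite trmx_mul trmxK.
have MT : M^T = M by rewrite linearB /= tr_scalar_mx G1T.
have NT : N^T = N by rewrite trmx_inv MT.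
(* By the rank 2 formula, moving entry [(a, j)] by [x] multiplies [\det M] by
   [1 + x * be + x ^+ 2 * co]. *)
pose co (n : nat) (A : 'M[R]_(n, k)) c (a : 'I_n) (j : 'I_k) :=
  c ^+ 2 * ((row a A *m N *m (delta_mx j 0 : 'cV[R]_k)) 0 0) ^+ 2 + c * N j j
     - c ^+ 2 * N j j * (row a A *m N *m (row a A)^T) 0 0.
pose be (n : nat) (A : 'M[R]_(n, k)) c (a : 'I_n) (j : 'I_k) :=
  2 * c * (row a A *m N *m (delta_mx j 0 : 'cV[R]_k)) 0 0.
have pM0 : (u - 1) *: (A1^T *m A1) + u *: (A2^T *m A2) = M.
  by rewrite -[RHS](pencil0 A1 A2 u (fun=> 0) hA) /pencil !scale0r !addr0.
(* At a coordinate vector both expressions are polynomials in [s], so their coefficients of [s ^+ 2]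
   agree. *)
have coefE (p : 'I_n1 * 'I_k + 'I_n2 * 'I_k) (b c : R) :
    (forall s, \det (pencil A1 A2 s u (fun q => (q == p)%:R)) = \det M * (1 + s * b + s ^+ 2 * c)) ->
  \sum_(m <- L | size m.1 == 2) m.2.[u] * \prod_(q <- m.1) (q == p)%:R = \det M * c.
  move=> h.
  pose Pp := \sum_(m <- L) (m.2.[u] * \prod_(q <- m.1) (q == p)%:R) *: 'X^(size m.1).
  have PpE : Pp = \det M *: (1 + b *: 'X + c *: 'X^2).
    apply: poly_horner_inj => s.
    transitivity (\det (pencil A1 A2 s u (fun q => (q == p)%:R))).
      rewrite hL horner_sum; apply: eq_bigr => m _.
      by rewrite hornerZ hornerXn mulrAC.
    by rewrite h !hornerE /=; ring.
  have := congr1 (fun P : {poly R} => P`_2) PpE.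
  rewrite !(coefZ, coefD, coef1, coefX, coefXn) /= mulr0 !add0r mulr1 => <-.
  rewrite coef_sum big_mkcond; apply: eq_bigr => m _.
  by rewrite coefZ coefXn eq_sym; case: eqP; rewrite ?mulr1 ?mulr0.
have dE (n : nat) (a : 'I_n) (j : 'I_k) : \matrix_(i, l) ((i, l) == (a, j))%:R = delta_mx a j :> 'M[R]_(n, k).
  by apply/matrixP => i l; rewrite !mxE.
have zE (n : nat) : \matrix_(i < n, l < k) false%:R = 0 :> 'M[R]_(n, k).
  by apply/matrixP => i l; rewrite !mxE.
under eq_bigr do rewrite mulr_sumr.
rewrite exchange_big big_sumType /=.
transitivity (\sum_(p : 'I_n1 * 'I_k) \det M * co n1 A1 (u - 1) p.1 p.2
  + \sum_(p : 'I_n2 * 'I_k) \det M * co n2 A2 u p.1 p.2).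
  congr (_ + _); apply: eq_bigr => -[a j] _ /=.
    apply: (coefE _ (be n1 A1 (u - 1) a j)) => s.
    rewrite -(det_rank_two_perturbation M (row a A1) j (u - 1) s uM MT) /pencil.
    rewrite (dE n1) zE scaler0 addr0 gram_delta_mx scalerDr -pM0.
    by rewrite addrAC.
  apply: (coefE _ (be n2 A2 u a j)) => s.
  rewrite -(det_rank_two_perturbation M (row a A2) j u s uM MT) /pencil.
  rewrite (dE n2) zE scaler0 addr0 gram_delta_mx [u *: (_ + _)]scalerDr -pM0.
  by rewrite addrA.
rewrite -!mulr_sumr -mulrDr; congr (_ * _).
rewrite -!(pair_bigA _ (fun a j => co _ _ _ a j)) /= !sum_rank_two_coef //.
have -> : A2^T *m A2 = 1%:M - A1^T *m A1 by rewrite -hA addrC addKr.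
(* The relation [N *m M = 1] eliminates [A1], so that only the traces [t1] and [t2] remain. *)
have NG : N *m (A1^T *m A1) = u *: N - 1%:M.
  rewrite -[1%:M](mulVmx uM) -/N /M mulmxBr mul_mx_scalar opprB addrCA subrr.
  by rewrite addr0.
rewrite !mulmxBr !mulmx1 -!mulmxA NG mulmxBr mulmx1 -scalemxAr.
have trB (A B : 'M[R]_k) : \tr (A - B) = \tr A - \tr B by rewrite raddfB.
rewrite !(trB, mxtraceZ) mxtrace1 -/t1 -/t2.
ring.
Qed.

(** * Moments of the entries and the expansion of [g] *)

Definition moment {d} {T : measurableType d} {R : realType} (P : probability T R)
    {I : Type} (X : I -> {RV P >-> R}) (t : seq I) : R :=
  (\int[P]_w (\prod_(p <- t) X p w))%R.

Lemma Rintegral_expansion {d} {T : measurableType d} {R : realType} (P : probability T R)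
    {I : Type} (X : I -> {RV P >-> R}) (L : seq (seq I * {poly R})) (s u : R) :
  (forall p, finite_moments (X p)) ->
  (\int[P]_w (\sum_(m <- L) m.2.[u] * s ^+ size m.1 * \prod_(p <- m.1) X p w))%R =
  \sum_(m <- L) m.2.[u] * s ^+ size m.1 * moment P X m.1.
Proof.
move=> hX.
(* Additivity of the integral requires integrable partial sums, so integrability is carried through
   the induction. *)
suff: P.-integrable setT (EFin \o (fun w =>
    \sum_(m <- L) m.2.[u] * s ^+ size m.1 * \prod_(p <- m.1) X p w)) /\
  (\int[P]_w (\sum_(m <- L) m.2.[u] * s ^+ size m.1 * \prod_(p <- m.1) X p w))%R =
  \sum_(m <- L) m.2.[u] * s ^+ size m.1 * moment P X m.1 by case.
elim: L => [|m L [iL eL]].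
  split.
    under eq_fun do rewrite big_nil.
    exact: finite_measure_integrable_cst.
  under eq_Rintegral do rewrite big_nil.
  by rewrite big_nil Rintegral_cst // mul0r.
have im : P.-integrable setT (EFin \o (fun w =>
    m.2.[u] * s ^+ size m.1 * \prod_(p <- m.1) X p w)).
  exact: (integrableZl measurableT _ (integrable_monomial P X hX m.1)).
split.
  under eq_fun do rewrite big_cons.
  exact: (integrableD measurableT im iL).
under eq_Rintegral do rewrite big_cons.
rewrite big_cons -eL RintegralD //; congr (_ + _).
by rewrite RintegralZl //; exact: integrable_monomial.
Qed.

Lemma g_moments {d} {T : measurableType d} {R : realType} (P : probability T R)
    {n1 n2 k : nat} (A1 : 'M[R]_(n1, k)) (A2 : 'M[R]_(n2, k))
    (X1 : 'I_n1 -> 'I_k -> {RV P >-> R}) (X2 : 'I_n2 -> 'I_k -> {RV P >-> R})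
    L (theta u : R) :
  (forall p, finite_moments (entries X1 X2 p)) ->
  has_expansion (fun s u x => \det (pencil A1 A2 s u x)) L ->
  g A1 A2 X1 X2 theta u =
  \sum_(m <- L) m.2.[u] * Num.sqrt theta ^+ size m.1 * moment P (entries X1 X2) m.1.
Proof.
move=> hX hL; rewrite -Rintegral_expansion // /g unlock.
congr fine; apply: eq_integral => w _; congr EFin.
exact: hL (Num.sqrt theta) u (fun p => entries X1 X2 p w).
Qed.

Section IndependentSymmetric.
Context {d : measure_display} {T : measurableType d} {R : realType}.
Context {P : probability T R} {I : finType} {X : I -> {RV P >-> R}}.
Context (indep : mutually_independent X).
Context (sym : forall p, symmetric_RV (X p)).
Context (var1 : forall p, 'V_P[X p] = 1%E).
Context (mom : forall p, finite_moments (X p)).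

Let integrable1 p : P.-integrable setT (EFin \o X p).
Proof. exact: (mom p 1%N). Qed.

Let expectation0 p : (\int[P]_w (X p w)%:E = 0)%E.
Proof. exact: expectation_symmetric. Qed.

Lemma moment0 : moment P X [::] = 1.
Proof.
rewrite /moment; under eq_Rintegral do rewrite big_nil.
by rewrite Rintegral_cst // mul1r /= probability_setT.
Qed.

Lemma moment1 p : moment P X [:: p] = 0.
Proof.
rewrite /moment; under eq_Rintegral do rewrite big_seq1.
by rewrite /Rintegral expectation0.
Qed.

(** As the entries are centred, the case [p = q] is the variance and the other case is a product of
    means. *)
Lemma moment2 p q : moment P X [:: p; q] = (p == q)%:R.
Proof.
rewrite /moment; under eq_Rintegral do rewrite big_cons big_seq1.
have [<-|pq] := eqVneq p q.
  rewrite /Rintegral; have := var1 p.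
  rewrite /variance !unlock => v1.
  rewrite -[RHS]/(fine 1%E) -v1; congr fine; apply: eq_integral => w _ /=.
  by rewrite expectation0 -[X p w]subr0.
have ipq : P.-integrable setT (EFin \o (fun w => X p w * X q w)).
  have := integrable_monomial P X mom [:: p; q].
  by under eq_fun do rewrite big_cons big_seq1.
rewrite /Rintegral (expectation_mul_independent P) // ?expectation0 ?mul0e // => A B mA mB.
(* Independence concerns whole families, so the pair is singled out by the index set of [p] and [q]
   and a family equal to [A] at [p] and to [B] elsewhere. *)
pose C r := if r == p then A else B.
have mC r : measurable (C r) by rewrite /C; case: ifP.
have := indep [set p; q]%SET C mC.
have qp : (q == p) = false by rewrite eq_sym (negPf pq).
rewrite big_setU1 ?inE //= big_set1 /C eqxx qp => <-; congr (P _).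
apply/seteqP; split=> [w [wA wB] r /=|w h].
  by rewrite !inE => /orP[] /eqP ->; rewrite ?eqxx ?qp.
split.
  by have := h p; rewrite /= !inE eqxx => /(_ isT).
by have := h q; rewrite /= !inE eqxx orbT qp => /(_ isT).
Qed.

(** Both sides are 1 if the two indices in [t] coincide and 0 otherwise. The right-hand form is the
    one summed in [expansion_degree2]. *)
Lemma moment_size2 t : size t = 2 -> moment P X t = \sum_p \prod_(q <- t) (q == p)%:R.
Proof.
case: t => [|a [|b []]] // _; rewrite moment2.
under eq_bigr do rewrite big_cons big_seq1.
rewrite (bigD1 a) //= eqxx mul1r eq_sym big1 ?addr0 // => p /negPf pa.
by rewrite eq_sym pa mul0r.
Qed.

End IndependentSymmetric.

(** * Limits at a simple root and derivatives of roots *)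

(* Since [(\sum 1/(u-l_j))^2 - \sum 1/(u-l_j)^2] has only simple poles, the
   right-hand side extends continuously across [u = l i]. *)
Lemma horner_at_simple_root {R : realType} {k : nat} (l : 'I_k -> R) (A a b : {poly R}) (i : 'I_k) :
  injective l ->
  (forall u, (forall j, u != l j) ->
    let t1 := \sum_j (u - l j)^-1 in let t2 := \sum_j (u - l j)^-1 ^+ 2 in
    A.[u] = (\prod_j (u - l j)) * (a.[u] * t1 + b.[u] * (t2 - t1 ^+ 2))) ->
  A.[l i] = (\prod_(j < k | j != i) (l i - l j)) *
    (a.[l i] - 2 * b.[l i] * \sum_(j < k | j != i) (l i - l j)^-1).
Proof.
move=> linj hA.
pose r := \prod_(j < k | j != i) ('X - (l j)%:P).
pose S1 u := \sum_(j < k | j != i) (u - l j)^-1.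
pose S2 u := \sum_(j < k | j != i) (u - l j)^-1 * (u - l j)^-1.
(* [H] is the right-hand side with [u - l i] cancelled. Splitting off the term [j = i] gives
   [t1 = (u - l i)^-1 + S1] and [t2 - t1 ^+ 2 = S2 - S1 ^+ 2 - 2 * S1 * (u - l i)^-1]: the double
   poles drop out. *)
pose H u := r.[u] * (a.[u] * (1 + (u - l i) * S1 u)
  + b.[u] * ((u - l i) * (S2 u - S1 u * S1 u) - 2 * S1 u)).
have rE u : r.[u] = \prod_(j < k | j != i) (u - l j).
  by rewrite horner_prod; apply: eq_bigr => j _; rewrite !hornerE.
have inv_cvg j : j != i -> (x - l j)^-1 @[x --> l i] --> (l i - l j)^-1.
  move=> ji; apply: cvgV; first by rewrite subr_eq0 (inj_eq linj) eq_sym.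
  by apply: cvgB; [exact: cvg_id|exact: cvg_cst].
have S1c : S1 x @[x --> l i] --> S1 (l i) by exact: (cvg_big add_continuous).
have S2c : S2 x @[x --> l i] --> S2 (l i).
  by apply: (cvg_big add_continuous) => j ji; apply: cvgM; exact: inv_cvg.
have Hc : H x @[x --> l i] --> H (l i).
  have lc : (x - l i) @[x --> l i] --> l i - l i by apply: cvgB; [exact: cvg_id|exact: cvg_cst].
  apply: cvgM; first exact: continuous_horner.
  apply: cvgD; apply: cvgM; try exact: continuous_horner.
    by apply: cvgD; [exact: cvg_cst|exact: cvgM].
  apply: cvgB; apply: cvgM => //; last exact: cvg_cst.
  by apply: cvgB => //; exact: cvgM.
have Hd : H x @[x --> (l i)^'] --> H (l i) by exact: cvg_within_filter Hc.
have Ad : A.[x] @[x --> (l i)^'] --> A.[l i].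
  by apply: cvg_within_filter; exact: continuous_horner.
(* The hypothesis speaks only of [u] off the roots, so the limits are compared in a punctured
   neighbourhood. *)
suff : A.[x] @[x --> (l i)^'] --> H (l i).
  move=> /(cvg_unique (@norm_hausdorff _ R^o) Ad) ->; rewrite /H rE subrr !mul0r addr0 mulr1 sub0r.
  by congr (_ * _); rewrite /S1; ring.
apply: cvg_trans Hd; apply: near_eq_cvg.
have near_neq : \forall x \near (l i)^', forall j, x != l j.
  apply: filter_forall => j; have [->|ji] := eqVneq j i.
    exact: nbhs_dnbhs_neq.
  have : \forall x \near l i, x - l j != 0.
    apply: (@cvgr_neq0 _ R^o _ (nbhs (l i)) _ _ (l i - l j)).
      by apply: cvgB; [exact: cvg_id|exact: cvg_cst].
    by rewrite subr_eq0 (inj_eq linj) eq_sym.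
  move=> /nbhs_dnbhs; apply: filterS => x; by rewrite subr_eq0.
near=> u.
have ul : forall j, u != l j by near: u.
rewrite hA // (bigD1 i) //= -rE /H.
have ui : u - l i != 0 by rewrite subr_eq0.
rewrite [\sum_j (u - l j)^-1](bigD1 i) //= [\sum_j _ ^+ 2](bigD1 i) //=.
have -> : \sum_(j < k | j != i) (u - l j)^-1 ^+ 2 = S2 u.
  by apply: eq_bigr => j _; rewrite expr2.
rewrite -/(S1 u); move: (S1 u) (S2 u) => p q.
by field.
Unshelve. all: by end_near. Qed.

Lemma right_derivative_cvg {R : realType} (f : R -> R) (dl : R) :
  is_right_derivative f 0 dl -> f h @[h --> 0^'+] --> f 0.
Proof.
move=> fd.
have h0 : h @[h --> (0 : R)^'+] --> (0 : R) by apply: cvg_at_right_filter; exact: cvg_id.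
have lim0 : (f (0 + h) - f 0) / h * h + f 0 @[h --> 0^'+] --> f 0.
  rewrite -[X in _ --> X]add0r -[X in _ --> X + _](mulr0 dl).
  by apply: cvgD; [exact: (cvgM fd h0)|exact: cvg_cst].
apply: cvg_trans lim0; apply: near_eq_cvg.
near=> h; have hp : h != 0 by rewrite gt_eqF //; near: h; exact: nbhs_right_gt.
by rewrite /= add0r mulfVK // subrK.
Unshelve. all: by end_near. Qed.

(** Dividing the equation by [h * r.[f h]] gives the difference quotient as [- (A.[f h] + rho h) /
    r.[f h]]; continuity of [f] at 0 from the right yields its limit. *)
Lemma right_derivative_of_root {R : realType} (eps : R) (f rho : R -> R) (r A : {poly R}) (l dl : R) :
  0 < eps -> f 0 = l -> r.[l] != 0 ->
  is_right_derivative f 0 dl ->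
  rho h @[h --> 0^'+] --> (0 : R) ->
  (forall h, 0 < h < eps -> (f h - l) * r.[f h] + h * (A.[f h] + rho h) = 0) ->
  is_right_derivative f 0 (- (A.[l] / r.[l])).
Proof.
move=> eps0 f0 rl0 fd rho0 hf.
have fl : f h @[h --> 0^'+] --> l by rewrite -f0; exact: right_derivative_cvg fd.
have pc (p : {poly R}) : p.[f h] @[h --> 0^'+] --> p.[l].
  by apply: (cvg_comp _ _ fl); exact: continuous_horner.
have lim : - ((A.[f h] + rho h) / r.[f h]) @[h --> 0^'+] --> - (A.[l] / r.[l]).
  apply: cvgN; apply: cvgM; last exact: cvgV.
  by rewrite -[X in _ --> X]addr0; exact: cvgD.
apply: cvg_trans lim; apply: near_eq_cvg.
have rn : \forall h \near 0^'+, r.[f h] != 0.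
  exact: (@cvgr_neq0 _ R^o _ _ _ _ _ (pc r)).
near=> h.
have hp : 0 < h by near: h; exact: nbhs_right_gt.
have he : h < eps by near: h; exact: nbhs_right_lt.
have rh : r.[f h] != 0 by near: h.
have hE : (f h - l) * r.[f h] + h * (A.[f h] + rho h) = 0 by apply: hf; rewrite hp.
have h0 : h != 0 by rewrite gt_eqF.
rewrite /= add0r f0; apply: (mulIf rh); apply: (mulIf h0).
rewrite mulNr mulfVK // mulrAC mulfVK //; apply/eqP; rewrite -subr_eq0; apply/eqP.
by rewrite -[RHS]oppr0 -hE; ring.
Unshelve. all: by end_near. Qed.

(** * Assembling the derivative formula *)

Theorem mainTheorem2 (R : realType) (d : measure_display)
    (T : measurableType d) (P : probability T R)
    (k n1 n2 : nat) (hk : (1 <= k)%N) (hn1 : (1 <= n1)%N) (hn2 : (1 <= n2)%N)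
    (A1 : 'M[R]_(n1, k)) (A2 : 'M[R]_(n2, k))
    (hA : A1^T *m A1 + A2^T *m A2 = 1%:M)
    (X1 : 'I_n1 -> 'I_k -> {RV P >-> R})
    (X2 : 'I_n2 -> 'I_k -> {RV P >-> R})
    (hindep : mutually_independent (entries X1 X2))
    (hident : forall s t, same_distribution P (entries X1 X2 s) (entries X1 X2 t))
    (hsym : forall s, symmetric_RV (entries X1 X2 s))
    (hvar : forall s, 'V_P[entries X1 X2 s] = 1%E)
    (hmom : forall s, finite_moments (entries X1 X2 s))
    (lambda0 : 'I_k -> R)
    (hroot : forall u : R, g A1 A2 X1 X2 0 u = 0 <-> exists i, u = lambda0 i)
    (hdistinct : injective lambda0)
    (eps : R) (heps : 0 < eps)
    (lambda : 'I_k -> R -> R)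
    (hdiff : forall i, differentiable_co (lambda i) 0 eps)
    (hinit : forall i, lambda i 0 = lambda0 i)
    (hzero : forall theta : R, 0 <= theta < eps ->
       forall i, g A1 A2 X1 X2 theta (lambda i theta) = 0)
    (i : 'I_k) :
  is_right_derivative (lambda i) 0
    (- n1%:R * (lambda0 i - 1) - n2%:R * lambda0 i
     + \sum_(j < k | j != i)
         (lambda0 i * (1 - lambda0 j) + lambda0 j * (1 - lambda0 i))
           / (lambda0 i - lambda0 j)).
Proof.
have [L hL] := expansion_det_pencil A1 A2.
pose X := entries X1 X2.
(* [A] is the coefficient of [theta]; [tail] collects the terms of degree above 2 after division by
   [theta], whence the exponent [size m.1 - 2]. *)
pose A : {poly R} := \sum_(m <- L | size m.1 == 2) moment P X m.1 *: m.2.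
pose tail (h u : R) := \sum_(m <- L | (2 < size m.1)%N)
  m.2.[u] * moment P X m.1 * Num.sqrt h ^+ (size m.1 - 2).
pose G := A1^T *m A1.
(* Terms of degree 1 vanish because the entries have mean 0. *)
have gE h u : 0 <= h -> g A1 A2 X1 X2 h u = \det (u%:M - G) + h * (A.[u] + tail h u).
  move=> h0; rewrite (g_moments P A1 A2 X1 X2 L h u hmom hL).
  rewrite -(expansion_degree0 A1 A2 L u hA hL) horner_sum mulrDr /tail !mulr_sumr.
  rewrite addrA [X in _ = X + _ + _]big_mkcond [X in _ = _ + X + _]big_mkcond [X in _ = _ + _ + X]big_mkcond 
    -!big_split /=; apply: eq_bigr => -[t c] _ /=.
  have h2 : Num.sqrt h ^+ 2 = h by exact: sqr_sqrtr.
  case: t => [|p [|q [|r t]]] /=.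
  - by rewrite (moment0 (P := P)) expr0 !mulr1 !addr0.
  - by rewrite (moment1 hsym hmom) mulr0 !addr0.
  - by rewrite h2 hornerZ add0r addr0; ring.
  - rewrite !add0r -{2}h2 [_ ^+ (size t).+3](_ : _ = Num.sqrt h ^+ 2 * Num.sqrt h ^+ (size t).+1).
      by rewrite subSS subSS subn0; ring.
    by rewrite -exprD.
have detG j : \det ((lambda0 j)%:M - G) = 0.
  have /hroot : exists i, lambda0 j = lambda0 i by exists j.
  by rewrite gE // mul0r addr0.
have GT : G^T = G by rewrite trmx_mul trmxK.
have [Q uQ QG] := symmetric_distinct_roots_diag G lambda0 GT hdistinct detG.
(* [r] is [g_0] divided by its factor at [lambda0 i], so its value there is the derivative of
   [g_0]. *)
pose r : {poly R} := \prod_(j < k | j != i) ('X - (lambda0 j)%:P).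
have rE u : r.[u] = \prod_(j < k | j != i) (u - lambda0 j).
  by rewrite horner_prod; apply: eq_bigr => j _; rewrite !hornerE.
have r0 : r.[lambda0 i] != 0.
  rewrite rE; apply/prodf_neq0 => j ji.
  by rewrite subr_eq0 (inj_eq hdistinct) eq_sym.
(* [a] and [b] are the coefficients of [t1] and [t2 - t1 ^+ 2] in [expansion_degree2]. *)
pose a : {poly R} := n1%:R *: ('X - 1) + n2%:R *: 'X + (1 - k%:R) *: (2 *: 'X - 1).
pose b : {poly R} := 'X * (1 - 'X).
have Aroot : A.[lambda0 i] = r.[lambda0 i] * (a.[lambda0 i] -
    2 * b.[lambda0 i] * \sum_(j < k | j != i) (lambda0 i - lambda0 j)^-1).
  rewrite rE; apply: horner_at_simple_root => // u ul t1 t2.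
  have [detM /(_ ul) [tr1 tr2]] := resolvent_diag G Q lambda0 u uQ QG.
  have uM : u%:M - G \in unitmx.
    by rewrite unitmxE unitfE detM; apply/prodf_neq0 => j _; rewrite subr_eq0.
  have := expansion_degree2 A1 A2 L u hA hL uM.
  rewrite -/G detM tr1 tr2 -/t1 -/t2 !hornerE => e2.
  transitivity (\sum_(m <- L | size m.1 == 2) m.2.[u] * \sum_p \prod_(q <- m.1) (q == p)%:R).
    rewrite horner_sum; apply: eq_bigr => m /eqP sz.
    by rewrite hornerZ mulrC (moment_size2 hindep hsym hvar hmom m.1 sz).
  by rewrite e2; congr (_ * _); ring.
have [dl hdl] := (hdiff i).1.
have rho0 : tail h (lambda i h) @[h --> 0^'+] --> (0 : R).
  have lc : lambda i h @[h --> 0^'+] --> lambda0 i.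
    by rewrite -(hinit i); exact: right_derivative_cvg hdl.
  have sc : Num.sqrt h @[h --> 0^'+] --> (0 : R).
    rewrite -[X in _ --> X]sqrtr0.
    by apply: cvg_at_right_filter; exact: sqrt_continuous.
  (* The limit is the sum with [sqrt h] replaced by 0, which vanishes because every exponent is
     positive. *)
  have tail0 : \sum_(m <- L | (2 < size m.1)%N)
      m.2.[lambda0 i] * moment P X m.1 * (0 : R) ^+ (size m.1 - 2) = 0.
    by rewrite big1 // => m sz; rewrite expr0n subn_eq0 leqNgt sz mulr0.
  rewrite -[X in _ --> X]tail0.
  apply: (cvg_big add_continuous) => m _; apply: cvgM; last by
    exact: (cvg_comp _ (fun x => x ^+ (size m.1 - 2)) sc (@exprn_continuous _ _ _)).
  apply: cvgM; last exact: cvg_cst.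
  by apply: (cvg_comp _ _ lc); exact: continuous_horner.
have := right_derivative_of_root eps (lambda i) (fun h => tail h (lambda i h)) r A
  (lambda0 i) dl heps (hinit i) r0 hdl rho0.
have key h : 0 < h < eps -> (lambda i h - lambda0 i) * r.[lambda i h] +
    h * (A.[lambda i h] + tail h (lambda i h)) = 0.
  move=> /andP[h0 he]; rewrite -[RHS](hzero h _ i) ?(ltW h0) // gE ?(ltW h0) //.
  have [-> _] := resolvent_diag G Q lambda0 (lambda i h) uQ QG.
  by rewrite rE [in RHS](bigD1 i).
move=> /(_ key); rewrite Aroot [r.[_] * _]mulrC mulfK //.
congr (is_right_derivative _ _ _).
(* With [x = lambda0 i] and [y = lambda0 j], each numerator is
   [2 * x * (1 - x) + (2 * x - 1) * (x - y)]; the second part contributes [2 * x - 1] for each of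
   the [k - 1] indices. *)
have -> : \sum_(j < k | j != i) (lambda0 i * (1 - lambda0 j) + lambda0 j * (1 - lambda0 i))
    / (lambda0 i - lambda0 j) =
  2 * lambda0 i * (1 - lambda0 i) * \sum_(j < k | j != i) (lambda0 i - lambda0 j)^-1
  + (k%:R - 1) * (2 * lambda0 i - 1).
  have -> : (k%:R - 1) * (2 * lambda0 i - 1) = \sum_(j < k | j != i) (2 * lambda0 i - 1).
    rewrite sumr_const cardC1 card_ord -[RHS]mulr_natl.
    by rewrite -subn1 natrB.
  rewrite mulr_sumr -big_split /=; apply: eq_bigr => j ji.
  have ne : lambda0 i - lambda0 j != 0 by rewrite subr_eq0 (inj_eq hdistinct) eq_sym.
  by field.
set S := \sum_(j < k | _) _; rewrite /a /b !hornerE /=.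
ring.
Qed.
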